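(* Let $N\in\mathbb{N}_0$ and $a\in\mathbb{R}$. Then for all $z,w\in\mathbb{C}$, $$S_{a,N}(z,w)=\int_{\mathbb{R}}M_N\left(\frac{z+\overline{z}}{\sqrt2}-x,\ \frac{w+\overline{w}}{\sqrt2}-x+a\right)A_z(x)\,\overline{A_w(x-a)}\,dx.$$
   Context: The Hermite polynomials $H_m$ are defined by $e^{2xz-z^2}=\sum_{m\ge0}\frac{H_m(x)}{m!}z^m$, and the Segal–Bargmann kernel is $A_z(x)=\pi^{-1/4}e^{-\frac12(x^2+z^2)+\sqrt2zx}$, $z\in\mathbb{C}$, $x\in\mathbb{R}$. For $m\in\mathbb{N}_0$, $a\in\mathbb{R}$, $z,w\in\mathbb{C}$, $$I_{a,m}(z,w):=\int_{\mathbb{R}}H_m\left(\frac{z+\overline{z}}{\sqrt2}-x\right)H_m\left(\frac{w+\overline{w}}{\sqrt2}-x+a\right)A_z(x)\,\overline{A_w(x-a)}\,dx,$$ $S_{a,N}(z,w)=\sum_{m=0}^{N}\frac{1}{2^mm!}I_{a,m}(z,w)$, and $$M_N(u,v)=\sum_{m=0}^{N}\frac{1}{2^mm!}H_m(u)H_m(v),\quad u,v\in\mathbb{R}$$ (by the Christoffel–Darboux formula, $M_N(u,v)=\frac{1}{N!2^{N+1}}\frac{H_N(v)H_{N+1}(u)-H_N(u)H_{N+1}(v)}{u-v}$ for $u\ne v$). *)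

(* Defs.v *)
From HB Require Import structures.
From mathcomp Require Import all_boot all_order all_algebra.
From mathcomp Require Import all_classical all_reals all_analysis.
From mathcomp Require Import complex.
From mathcomp Require Import ring lra.

Set Implicit Arguments.
Unset Strict Implicit.
Unset Printing Implicit Defensive.

Import Order.TTheory GRing.Theory Num.Theory.
Import numFieldNormedType.Exports.

Local Open Scope classical_set_scope.
Local Open Scope ring_scope.
Local Open Scope complex_scope.

Section Hermite.
Context {R : realType}.

(* The coefficients of the expansion are determined by its values at real z,
   so the generating function is only required at real x and z. *)
Definition hermite_generating (H : nat -> {poly R}) : Prop :=
  forall x z : R,
    series (fun m => (H m).[x] / m`!%:R * z ^+ m) @ \oo
      --> expR (2 * x * z - z ^+ 2).

Let entire (c : nat -> R) :=
  forall K, 0 < K -> exists C, forall n, `|c n| <= C * K ^+ n.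

Let entire_diffs c : entire c -> entire (pseries_diffs c).
Proof.
move=> ec K K0; have K20 : 0 < K / 2 by rewrite divr_gt0.
have [C cC] := ec _ K20; exists (C * (K / 2)) => n.
have C0 : 0 <= C by have := le_trans (normr_ge0 _) (cC 0%N); rewrite expr0 mulr1.
rewrite /pseries_diffs normrM normr_nat.
apply: (@le_trans _ _ (2 ^+ n * (C * (K / 2) ^+ n.+1))).
  by apply: ler_pM => //; rewrite -natrX ler_nat ltn_expl.
rewrite exprS expr_div_n.
have h : (2 : R) ^+ n != 0 by rewrite expf_neq0.
by rewrite le_eqVlt; apply/orP; left; apply/eqP; field.
Qed.

Let cvg_entire c z : entire c -> cvgn (pseries c z).
Proof.
move=> ec; have K0 : 0 < (2 * (`|z| + 1))^-1 by rewrite invr_gt0 mulr_gt0// ltr_wpDl.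
have [C cC] := ec _ K0.
have C0 : 0 <= C by have := le_trans (normr_ge0 _) (cC 0%N); rewrite expr0 mulr1.
apply: normed_cvg; apply: (@series_le_cvg _ _ (geometric C 2^-1)) => [n|n|n|].
- exact: normr_ge0.
- by rewrite /= mulr_ge0// exprn_ge0// invr_ge0.
- rewrite [leLHS]/= normrM normrX [leRHS]/=.
  apply: (@le_trans _ _ (C * ((2 * (`|z| + 1))^-1) ^+ n * (`|z| + 1) ^+ n)).
    by apply: ler_pM => //; apply: lerXn2r; rewrite ?nnegrE ?lerDl// addr_ge0.
  have h : `|z| + 1 != 0 by rewrite gt_eqF// ltr_wpDl.
  by rewrite -mulrA -exprMn invfM -mulrA mulVf// mulr1.
- apply: is_cvg_geometric_series; rewrite ger0_norm//; lra.
Qed.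

Let entire_rec (x : R) (c : nat -> R) :
  (forall n, n.+2%:R * c n.+2 = 2 * x * c n.+1 - 2 * c n) -> entire c.
Proof.
move=> cE K K0.
pose B := (2 * `|x| * K + 2) / K ^+ 2.
pose M := (Num.truncn B).+1.
have BM n : (M <= n)%N -> B <= n%:R.
  move=> Mn; apply: ltW; apply: (lt_le_trans (truncnS_gt B)).
  by rewrite ler_nat.
pose C := \sum_(i < M.+2) `|c i| / K ^+ i.
have small i : (i < M.+2)%N -> `|c i| <= C * K ^+ i.
  move=> iM; rewrite -ler_pdivrMr ?exprn_gt0// /C (bigD1 (Ordinal iM))//=.
  by rewrite lerDl sumr_ge0// => j _; rewrite divr_ge0// exprn_ge0// ltW.
exists C => n.
suff: `|c n| <= C * K ^+ n /\ `|c n.+1| <= C * K ^+ n.+1 by case.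
elim: n => [|n [IH1 IH2]]; first by split; apply: small.
split=> //; have [nM|Mn] := ltnP n.+2 M.+2; first exact: small.
rewrite -(ler_pM2l (ltr0Sn R n.+1)) -[X in X * `|_|]normr_nat -normrM cE.
apply: (le_trans (ler_normB _ _)); rewrite !normrM !normr_nat.
have C0 : 0 <= C by apply: sumr_ge0 => j _; rewrite divr_ge0// exprn_ge0// ltW.
have CK0 : 0 <= C * K ^+ n by rewrite mulr_ge0// exprn_ge0// ltW.
apply: (@le_trans _ _ (B * (C * K ^+ n.+2))); last first.
  apply: ler_wpM2r; first by rewrite mulr_ge0// exprn_ge0// ltW.
  by apply: BM; rewrite ltnW// ltnW.
have -> : B * (C * K ^+ n.+2) = 2 * `|x| * (C * K ^+ n.+1) + 2 * (C * K ^+ n).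
  by rewrite /B !exprS; field; rewrite gt_eqF.
by apply: lerD; apply: ler_wpM2l => //; rewrite mulr_ge0.
Qed.

Let hermite2 := fix F n : {poly R} * {poly R} :=
  if n is k.+1 then
    ((F k).2, 2%:P * 'X * (F k).2 - (2 * k.+1%:R)%:P * (F k).1)
  else (1, 2%:P * 'X).

Lemma hermite_generating_exists :
  exists H : nat -> {poly R}, hermite_generating H.
Proof.
exists (fun n => (hermite2 n).1) => x z.
pose c m := (hermite2 m).1.[x] / m`!%:R.
have c0 : c 0%N = 1 by rewrite /c /= hornerE invr1 mulr1.
have c1 : c 1%N = 2 * x by rewrite /c /= !hornerE invr1 mulr1.
have cE n : n.+2%:R * c n.+2 = 2 * x * c n.+1 - 2 * c n.
  rewrite /c /= hornerD hornerN !hornerM !hornerC hornerX !factS !natrM.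
  have h : (n`!%:R : R) != 0 by rewrite pnatr_eq0 -lt0n fact_gt0.
  have h1 : (n.+1%:R : R) != 0 by rewrite pnatr_eq0.
  have h2 : (n.+2%:R : R) != 0 by rewrite pnatr_eq0.
  move: h1 h2; move: (n.+1%:R : R) (n.+2%:R : R) => p q h1 h2.
  by field; rewrite h h1 h2.
have ec : entire c := entire_rec cE.
pose F t := limn (pseries c t).
have dF t : is_derive t (1 : R) F ((2 * x - 2 * t) * F t).
  have -> : (2 * x - 2 * t) * F t = limn (pseries (pseries_diffs c) t).
    apply/esym/cvg_lim => //; rewrite -cvg_shiftS.
    have -> : (fun n => pseries (pseries_diffs c) t n.+1) =
              (fun n => 2 * x * pseries c t n.+1 - 2 * t * pseries c t n).
      apply/funext => n; rewrite /pseries /series /= !mulr_sumr.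
      rewrite big_nat_recl// [X in _ = X - _]big_nat_recl//.
      rewrite /pseries_diffs c0 c1 -addrA -sumrB; congr (_ + _).
        by rewrite !expr0; ring.
      apply: eq_bigr => i _; rewrite cE exprS; ring.
    rewrite mulrBl; apply: cvgB; apply: cvgMl_tmp.
      by rewrite (cvg_shiftS (pseries c t)); apply: cvg_entire.
    exact: cvg_entire.
  apply: (@pseries_snd_diffs _ c (`|t| + 1)).
  - exact: cvg_entire.
  - by apply: cvg_entire; apply: entire_diffs.
  - by apply: cvg_entire; do 2 apply: entire_diffs.
  - by rewrite [ltRHS]ger0_norm ?addr_ge0// ltrDl.
have F0 : F 0 = 1.
  apply/cvg_lim => //; rewrite -cvg_shiftS.
  rewrite (_ : (fun n => _) = cst 1); first exact: cvg_cst.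
  apply/funext => n; rewrite /pseries /series /= big_nat_recl// c0 expr0 mulr1.
  by rewrite big1 ?addr0// => i _; rewrite expr0n mulr0.
pose G t := F t * expR (t ^+ 2 - 2 * x * t).
have GE : G z = G 0.
  apply: is_derive_0_is_cst => t; rewrite /G.
  apply: trigger_derive; rewrite /GRing.scale /=.
  ring.
have <- : F z = expR (2 * x * z - z ^+ 2).
  have {}GE : F z * expR (z ^+ 2 - 2 * x * z) = 1.
    by rewrite -/(G z) GE /G F0 mul1r expr0n mulr0 subr0 expR0.
  have -> : 2 * x * z - z ^+ 2 = - (z ^+ 2 - 2 * x * z) by ring.
  have e0 : expR (z ^+ 2 - 2 * x * z) != 0 by rewrite gt_eqF// expR_gt0.
  by rewrite expRN; apply: (mulIf e0); rewrite GE mulVf.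
exact: cvg_entire.
Qed.

Definition hermite : nat -> {poly R} := projT1 (cid hermite_generating_exists).

Lemma hermiteP : hermite_generating hermite.
Proof. exact: projT2 (cid hermite_generating_exists). Qed.

End Hermite.

Section SegalBargmann.
Context {R : realType}.
Implicit Types (a x u v : R) (z w : R[i]).

Definition cexp z : R[i] :=
  (expR (complex.Re z) * cos (complex.Im z)) +i*
  (expR (complex.Re z) * sin (complex.Im z)).

(* Only meaningful when Re \o f and Im \o f are Lebesgue integrable, as for the
   integrands below, which are polynomials times Gaussians. *)
Definition cintegral (f : R -> R[i]) : R[i] :=
  (\int[lebesgue_measure]_x complex.Re (f x)) +i*
  (\int[lebesgue_measure]_x complex.Im (f x)).

Definition sb_kernel z x : R[i] :=
  (pi `^ (- 4^-1))%:C *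
  cexp (- 2^-1 * ((x ^+ 2)%:C + z ^+ 2) + (Num.sqrt 2)%:C * z * x%:C).

Definition sb_I a (m : nat) z w : R[i] :=
  cintegral (fun x =>
    ((hermite m).[complex.Re (z + z^*) / Num.sqrt 2 - x] *
     (hermite m).[complex.Re (w + w^*) / Num.sqrt 2 - x + a])%:C *
    sb_kernel z x * (sb_kernel w (x - a))^*).

Definition sb_S a (N : nat) z w : R[i] :=
  \sum_(0 <= m < N.+1) ((2 ^+ m * m`!%:R)^-1)%:C * sb_I a m z w.

Definition hermite_M (N : nat) u v : R :=
  \sum_(0 <= m < N.+1) (2 ^+ m * m`!%:R)^-1 * (hermite m).[u] * (hermite m).[v].

End SegalBargmann.

(* Main.v *)
Require Import Defs.
From mathcomp Require Import all_boot all_order all_algebra.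
From mathcomp Require Import all_classical all_reals all_analysis.
From mathcomp Require Import measurable_realfun complex.
From mathcomp Require Import ring lra.

Set Implicit Arguments.
Unset Strict Implicit.

(** By definition M_N is the weighted sum of the products H_m H_m, so the claim
    is that a finite sum may be pulled out of the integral.  The integral of a
    non-integrable function is a default value, hence the substance is that
    each integrand

        H_m(A - x) H_m(B - x + a) A_z(x) conj(A_w(x - a))

    is integrable.  This is a bookkeeping of decay rates.  Say that f has a
    Gaussian tail of rate k if f is measurable and bounded by a constant times
    exp(c |x| - k x^2).  The linear term c |x| makes the notion robust: it
    absorbs polynomial factors, which therefore have rate 0
    ([gaussian_tail_horner]), and translations, which therefore preserve the
    rate ([gaussian_tail_shift]); and rates add up under products
    ([gaussian_tailM]).  Since |A_z(x)| is a constant times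
    exp(- x^2 / 2 + sqrt 2 Re(z) x), the kernel has rate 1/2
    ([cgaussian_tail_sb_kernel]), so the integrand above has rate
    0 + 1/2 + 1/2, which is positive and thus gives integrability by comparison
    with a normal density ([gaussian_tail_integrable]).  Linearity of the
    complex integral ([cintegral_sum]) then concludes. *)

Import Order.TTheory GRing.Theory Num.Theory.
Local Open Scope ring_scope.
Local Open Scope complex_scope.

(** * Finite linear combinations under the integral sign *)

Lemma Rintegral_lincomb d (T : measurableType d) (R : realType)
    (mu : {measure set T -> \bar R}) (D : set T) (I : Type) (s : seq I)
    (c : I -> R) (h : I -> T -> R) :
  measurable D -> (forall i, mu.-integrable D (EFin \o h i)) ->
  Rintegral mu D (fun x => \sum_(i <- s) c i * h i x) =
  \sum_(i <- s) c i * Rintegral mu D (h i).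
Proof.
move=> mD inth.
have intch i : mu.-integrable D (EFin \o (fun x => c i * h i x)).
  exact: integrableZl (inth i).
elim: s => [|j s IH].
  rewrite big_nil; under eq_Rintegral do rewrite big_nil.
  by rewrite /Rintegral integral0.
rewrite big_cons -IH -RintegralZl// -RintegralD//.
  by apply: eq_Rintegral => x _; rewrite big_cons.
apply: (eq_integrable mD (fun x => \sum_(i <- s) (c i * h i x)%:E)%E).
  by move=> x _; rewrite /= sumEFin.
by apply: integrable_sum => // i _; exact: intch.
Qed.

(** * Real functions with Gaussian decay *)

Section GaussianTail.
Context {R : realType}.
Implicit Types (a k l C c : R) (f g : R -> R) (p : {poly R}).

(** At rate k = 0 the bound still permits exponential growth, which is what
    makes room for polynomials and bounded factors. *)
Definition gaussian_tail k f :=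
  measurable_fun [set: R] f /\
  exists C c, forall x, `|f x| <= C * expR (c * `|x| - k * x ^+ 2).

Lemma gaussian_bound_ge0 k f C c :
  (forall x, `|f x| <= C * expR (c * `|x| - k * x ^+ 2)) -> 0 <= C.
Proof.
by move=> /(_ 0) /(le_trans (normr_ge0 _)); rewrite pmulr_lge0// expR_gt0.
Qed.

Lemma gaussian_tailD k f g :
  gaussian_tail k f -> gaussian_tail k g ->
  gaussian_tail k (fun x => f x + g x).
Proof.
move=> [mf [C [c Cf]]] [mg [D [d Dg]]]; split; first exact: measurable_funD.
have C0 := gaussian_bound_ge0 Cf.
have D0 := gaussian_bound_ge0 Dg.
exists (C + D), (Num.max c d) => x.
apply: (le_trans (ler_normD _ _)); rewrite mulrDl lerD//.
  apply: (le_trans (Cf x)); rewrite ler_wpM2l// ler_expR lerD2r.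
  by rewrite ler_wpM2r// le_max lexx.
apply: (le_trans (Dg x)); rewrite ler_wpM2l// ler_expR lerD2r.
by rewrite ler_wpM2r// le_max lexx orbT.
Qed.

Lemma gaussian_tailM k l f g :
  gaussian_tail k f -> gaussian_tail l g ->
  gaussian_tail (k + l) (fun x => f x * g x).
Proof.
move=> [mf [C [c Cf]]] [mg [D [d Dg]]]; split; first exact: measurable_funM.
exists (C * D), (c + d) => x; rewrite normrM.
apply: (le_trans (ler_pM _ _ (Cf x) (Dg x))) => //.
rewrite mulrACA -expRD le_eqVlt; apply/orP; left; apply/eqP.
by congr (_ * expR _); ring.
Qed.

Lemma gaussian_tail_cst C : gaussian_tail 0 (fun=> C).
Proof.
split; first exact: measurable_cst.
by exists `|C|, 0 => x; rewrite !mul0r subr0 expR0 mulr1.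
Qed.

Lemma gaussian_tailN k f :
  gaussian_tail k f -> gaussian_tail k (fun x => - f x).
Proof.
move=> [mf [C [c Cf]]]; split; first exact: measurableT_comp.
by exists C, c => x; rewrite normrN.
Qed.

(** The variable has rate 0 because |x| <= 1 + |x| <= exp |x|; polynomials are
    built from it and constants by sums and products. *)
Lemma gaussian_tail_horner p : gaussian_tail 0 (fun x => p.[x]).
Proof.
elim/poly_ind: p => [|p C IH].
  rewrite (_ : (fun x => _) = fun=> 0); first exact: gaussian_tail_cst.
  by apply/funext => x; rewrite horner0.
rewrite (_ : (fun x => _) = fun x => p.[x] * x + C); last first.
  by apply/funext => x; rewrite hornerMXaddC.
apply: gaussian_tailD; last exact: gaussian_tail_cst.
rewrite -[X in gaussian_tail X]addr0; apply: gaussian_tailM => //.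
split; first exact: measurable_id.
exists 1, 1 => x; rewrite !mul1r mul0r subr0.
by apply: le_trans (expR_ge1Dx _); rewrite lerDr.
Qed.

(** Expanding - k (x - a)^2 leaves - k x^2, a cross term 2 k a x, which goes
    into the coefficient of |x|, and a constant. *)
Lemma gaussian_tail_shift k a f :
  gaussian_tail k f -> gaussian_tail k (fun x => f (x - a)).
Proof.
move=> [mf [C [c Cf]]]; split.
  by apply: measurableT_comp => //; exact: measurable_funB.
have C0 := gaussian_bound_ge0 Cf.
exists (C * expR (`|c| * `|a| - k * a ^+ 2)), (`|c| + `|2 * k * a|) => x.
apply: (le_trans (Cf _)); rewrite -mulrA -expRD ler_wpM2l// ler_expR.
have h1 : c * `|x - a| <= `|c| * (`|x| + `|a|).
  apply: (@le_trans _ _ (`|c| * `|x - a|)).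
    by rewrite ler_wpM2r// ler_norm.
  by rewrite ler_wpM2l// ler_normB.
have h2 : 2 * k * a * x <= `|2 * k * a| * `|x| by rewrite -normrM ler_norm.
rewrite (_ : k * (x - a) ^+ 2 = k * x ^+ 2 + k * a ^+ 2 - 2 * k * a * x).
  by move: h1 h2; rewrite mulrDr mulrDl; lra.
by ring.
Qed.

(** Half of the quadratic decay pays for the linear term: by completing the
    square, c |x| <= k x^2 / 2 + c^2 / (2 k).  What remains, exp(- k x^2 / 2),
    is up to scaling the centred normal density of variance 1 / k. *)
Lemma gaussian_tail_integrable k f : 0 < k -> gaussian_tail k f ->
  (@lebesgue_measure R).-integrable [set: R] (EFin \o f).
Proof.
move=> k0 [mf [C [c Cf]]].
have C0 := gaussian_bound_ge0 Cf.
pose s := (Num.sqrt k)^-1.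
have s2 : s ^+ 2 = k^-1 by rewrite exprVn sqr_sqrtr// ltW.
have s0 : s != 0 by rewrite invr_eq0 gt_eqF// sqrtr_gt0.
pose D := C * expR (c ^+ 2 / (2 * k)).
pose E := D / normal_peak s.
pose g x := (E%:E * (normal_pdf 0 s x)%:E)%E.
apply: (@le_integrable _ (measurableTypeR R) _ _ _ _ _ g) => //.
- exact/measurable_EFinP.
- move=> x _; rewrite /g /= lee_fin; apply: le_trans (ler_norm _).
  rewrite normal_pdfE// mulrA /E divfK ?gt_eqF ?normal_peak_gt0//.
  apply: (le_trans (Cf x)); rewrite /D -mulrA -expRD ler_wpM2l// ler_expR.
  rewrite subr0 s2 -mulr_natr -subr_ge0.
  rewrite (_ : _ - _ = (k * `|x| - c) ^+ 2 / (2 * k)).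
    by rewrite divr_ge0 ?sqr_ge0// mulr_ge0// ltW.
  by rewrite -(real_normK (num_real x)); field; rewrite gt_eqF.
- by apply: integrableZl => //; exact: integrable_normal_pdf.
Qed.

End GaussianTail.

(** * Complex-valued functions and the Segal-Bargmann kernel *)

Section ComplexValued.
Context {R : realType}.
Implicit Types (f g : R -> R[i]).

Definition cgaussian_tail (k : R) f :=
  gaussian_tail k (fun x => complex.Re (f x)) /\
  gaussian_tail k (fun x => complex.Im (f x)).

Lemma cgaussian_tailM k l f g :
  cgaussian_tail k f -> cgaussian_tail l g ->
  cgaussian_tail (k + l) (fun x => f x * g x).
Proof.
move=> [rf jf] [rg jg]; split.
  rewrite (_ : (fun x => _) = fun x =>
      complex.Re (f x) * complex.Re (g x) +
      - (complex.Im (f x) * complex.Im (g x))); last first.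
    by apply/funext => x; case: (f x) => ? ?; case: (g x).
  apply: gaussian_tailD; first exact: gaussian_tailM.
  by apply: gaussian_tailN; exact: gaussian_tailM.
rewrite (_ : (fun x => _) = fun x =>
    complex.Re (f x) * complex.Im (g x) +
    complex.Im (f x) * complex.Re (g x)); last first.
  by apply/funext => x; case: (f x) => ? ?; case: (g x).
by apply: gaussian_tailD; exact: gaussian_tailM.
Qed.

Lemma cgaussian_tail_conj k f :
  cgaussian_tail k f -> cgaussian_tail k (fun x => (f x)^*).
Proof.
move=> [rf jf]; split.
  rewrite (_ : (fun x => _) = fun x => complex.Re (f x))//.
  by apply/funext => x; case: (f x).
rewrite (_ : (fun x => _) = fun x => - complex.Im (f x)).
  exact: gaussian_tailN.
by apply/funext => x; case: (f x).
Qed.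

Lemma cgaussian_tail_real k (f : R -> R) :
  gaussian_tail k f -> cgaussian_tail k (fun x => (f x)%:C).
Proof.
move=> kf; split => //=; have := gaussian_tailM kf (gaussian_tail_cst 0).
by rewrite addr0; under eq_fun do rewrite mulr0.
Qed.

(** Write z = u + i v.  The exponent of the kernel has real part
    - (x^2 + u^2 - v^2) / 2 + sqrt 2 u x, responsible for the decay, and an
    imaginary part that is affine in x and only contributes a bounded
    oscillation, of rate 0. *)
Lemma cgaussian_tail_sb_kernel (z : R[i]) :
  cgaussian_tail 2^-1 (sb_kernel z).
Proof.
case: z => u v.
rewrite -[X in cgaussian_tail X]add0r; apply: cgaussian_tailM.
  by apply: cgaussian_tail_real; exact: gaussian_tail_cst.
pose q (x : R) := - 2^-1 * (x ^+ 2 + (u ^+ 2 - v ^+ 2)) + Num.sqrt 2 * u * x.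
pose t (x : R) := - 2^-1 * (u * v *+ 2) + Num.sqrt 2 * v * x.
rewrite (_ : (fun x => _) = fun x =>
  (expR (q x) * cos (t x)) +i* (expR (q x) * sin (t x))); last first.
  apply/funext => x; rewrite /cexp.
  set e := (- 2^-1 * _ + _).
  suff -> : e = q x +i* t x by [].
  have h : (2^-1 : R[i]) = (2^-1)%:C by rewrite fmorphV rmorph_nat.
  rewrite /e h /q /t !expr2; apply/eqP; rewrite eq_complex /=.
  by apply/andP; split; apply/eqP; ring.
have mt : measurable_fun [set: R] t.
  apply: measurable_funD => //; exact: measurable_funM.
have qt : gaussian_tail 2^-1 (fun x => expR (q x)).
  split.
    apply: measurableT_comp => //; apply: measurable_funD => //.
    by apply: measurable_funM => //; exact: measurable_funD.
  exists (expR (- 2^-1 * (u ^+ 2 - v ^+ 2))), `|Num.sqrt 2 * u| => x.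
  rewrite ger0_norm ?expR_ge0// -expRD ler_expR /q.
  have : Num.sqrt 2 * u * x <= `|Num.sqrt 2 * u| * `|x|.
    by rewrite -normrM ler_norm.
  lra.
split => /=; rewrite -[X in gaussian_tail X]addr0; apply: gaussian_tailM => //.
  split.
    apply: measurableT_comp mt; apply: continuous_measurable_fun.
    exact: continuous_cos.
  by exists 1, 0 => x; rewrite !mul0r subr0 expR0 mulr1 cos_max.
split.
  apply: measurableT_comp mt; apply: continuous_measurable_fun.
  exact: continuous_sin.
by exists 1, 0 => x; rewrite !mul0r subr0 expR0 mulr1 sin_max.
Qed.

Definition cintegrable f :=
  let mu := @lebesgue_measure R in
  mu.-integrable [set: R] (EFin \o (fun x => complex.Re (f x))) /\
  mu.-integrable [set: R] (EFin \o (fun x => complex.Im (f x))).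

Lemma cgaussian_tail_integrable k f :
  0 < k -> cgaussian_tail k f -> cintegrable f.
Proof. by move=> k0 [rf jf]; split; apply: gaussian_tail_integrable; eauto. Qed.

Lemma cintegral_sum (I : Type) (s : seq I) (c : I -> R) (F : I -> R -> R[i]) :
  (forall i, cintegrable (F i)) ->
  cintegral (fun x => \sum_(i <- s) (c i)%:C * F i x) =
  \sum_(i <- s) (c i)%:C * cintegral (F i).
Proof.
move=> intF.
have reE x : complex.Re (\sum_(i <- s) (c i)%:C * F i x) =
             \sum_(i <- s) c i * complex.Re (F i x).
  elim: (s) => [|i t IH]; rewrite ?big_nil ?big_cons// -IH.
  case: (F i x) => ? ?; case: (\sum_(_ <- _) _) => ? ? /=.
  by rewrite mul0r subr0.
have imE x : complex.Im (\sum_(i <- s) (c i)%:C * F i x) =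
             \sum_(i <- s) c i * complex.Im (F i x).
  elim: (s) => [|i t IH]; rewrite ?big_nil ?big_cons// -IH.
  case: (F i x) => ? ?; case: (\sum_(_ <- _) _) => ? ? /=.
  by rewrite mul0r addr0.
rewrite /cintegral; under eq_Rintegral do rewrite reE.
rewrite Rintegral_lincomb//; last by move=> i; case: (intF i).
under eq_Rintegral do rewrite imE.
rewrite Rintegral_lincomb//; last by move=> i; case: (intF i).
elim: s {reE imE} => [|i t IH]; rewrite ?big_nil ?big_cons// -IH.
by apply/eqP; rewrite eq_complex /= !mul0r subr0 addr0 !eqxx.
Qed.

End ComplexValued.

(** * The summed integral *)

Theorem proposition6p20 (R : realType) (N : nat) (a : R) (z w : R[i]) :
  sb_S a N z w =
  cintegral (fun x : R =>
    (hermite_M N (complex.Re (z + z^*) / Num.sqrt 2 - x)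
                 (complex.Re (w + w^*) / Num.sqrt 2 - x + a))%:C *
    sb_kernel z x * (sb_kernel w (x - a))^*).
Proof.
set A := complex.Re (z + z^*) / Num.sqrt 2.
set B := complex.Re (w + w^*) / Num.sqrt 2.
rewrite /sb_S /sb_I -/A -/B -cintegral_sum => [|m].
  congr cintegral; apply/funext => x.
  rewrite /hermite_M rmorph_sum -mulrA mulr_suml.
  by apply: eq_bigr => m _; rewrite -!mulrA !rmorphM !mulrA.
apply: (@cgaussian_tail_integrable _ (0 + 2^-1 + 2^-1)); first lra.
apply: cgaussian_tailM.
  apply: cgaussian_tailM (cgaussian_tail_sb_kernel z).
  apply: cgaussian_tail_real.
  pose p := (hermite m \Po (A%:P - 'X)) * (hermite m \Po (B%:P - 'X + a%:P)).
  rewrite (_ : (fun x => _) = fun x => p.[x]).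
    exact: gaussian_tail_horner.
  by apply/funext => x; rewrite /p hornerM !horner_comp !hornerE.
apply: cgaussian_tail_conj.
have [rw jw] := cgaussian_tail_sb_kernel w.
by split; [exact: (gaussian_tail_shift a rw)|exact: (gaussian_tail_shift a jw)].
Qed.
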